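(* Let $f:\mathbb{R}^m\to\mathbb{R}$ and $\mathcal{F}\subseteq\mathbb{R}^m$, and assume that $\operatorname{argmin}_{x\in\mathcal{F}}f(x)\ne\emptyset$. If $\bar x\in\mathcal{F}$ is a local minimizer of $\min_{x\in\mathcal{F}}f(x)$ and $f$ is directionally differentiable at $\bar x$ and locally Lipschitz continuous near $\bar x$, then $f'(\bar x;d)\ge0$ for all $d\in\mathcal{T}_{\mathcal{F}}(\bar x)$. Moreover, if $f$ is twice directionally differentiable at $\bar x$, then $f^{(2)}(\bar x;d)\ge0$ for all $d\in P_{\mathcal{F}}(\bar x)\cap\{d\in\mathbb{R}^m\mid f'(\bar x;d)=0\}$.
   Context: Directional derivative: $f'(x;d)=\lim_{\tau\downarrow0}\frac{f(x+\tau d)-f(x)}{\tau}$; second-order directional derivative: $f^{(2)}(x;d)=\lim_{\tau\downarrow0}\frac{f(x+\tau d)-f(x)-\tau f'(x;d)}{\tau^2/2}$. $f$ is (twice) directionally differentiable at $x$ if the first limit exists (both limits exist) for all $d\in\mathbb{R}^m$. $f$ is locally Lipschitz continuous near $x$ if it is Lipschitz on some neighborhood of $x$. For $\mathcal{F}\subseteq\mathbb{R}^m$ and $x\in\mathcal{F}$: tangent cone $\mathcal{T}_{\mathcal{F}}(x)=\{d\mid\exists\,x^k\to x,\ x^k\in\mathcal{F},\ \tau_k\downarrow0\text{ with }(x^k-x)/\tau_k\to d\}$; radial cone $P_{\mathcal{F}}(x)=\{d\mid\exists\,\tau_k\downarrow0\text{ such that }x+\tau_kd\in\mathcal{F}\text{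 for all }k\}$. *)

(* Defs.v *)
From mathcomp Require Import all_boot all_order all_algebra.
From mathcomp Require Import all_classical all_reals topology normedtype.

Set Implicit Arguments.
Unset Strict Implicit.
Unset Printing Implicit Defensive.

Import Order.TTheory GRing.Theory Num.Theory.
Import numFieldNormedType.Exports.

Local Open Scope classical_set_scope.
Local Open Scope ring_scope.

(* The norm on 'rV[R]_m is the sup norm; convergence, neighbourhoods and the
   Lipschitz property do not depend on the choice of norm on R^m. *)

Definition dquot (R : realType) (m : nat) (f : 'rV[R]_m -> R)
    (x d : 'rV[R]_m) (t : R) : R :=
  (f (x + t *: d) - f x) / t.

(* [lim] is total: [ddir f x d] is meaningful when [dquot f x d @ 0^'+]
   converges, as [ddifferentiable f x] requires for every [d]; likewise for
   [ddir2] below. *)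
Definition ddir (R : realType) (m : nat) (f : 'rV[R]_m -> R)
    (x d : 'rV[R]_m) : R :=
  lim (dquot f x d t @[t --> 0^'+]).

Definition ddifferentiable (R : realType) (m : nat) (f : 'rV[R]_m -> R)
    (x : 'rV[R]_m) : Prop :=
  forall d, cvg (dquot f x d t @[t --> 0^'+]).

Definition dquot2 (R : realType) (m : nat) (f : 'rV[R]_m -> R)
    (x d : 'rV[R]_m) (t : R) : R :=
  (f (x + t *: d) - f x - t * ddir f x d) / (t ^+ 2 / 2).

Definition ddir2 (R : realType) (m : nat) (f : 'rV[R]_m -> R)
    (x d : 'rV[R]_m) : R :=
  lim (dquot2 f x d t @[t --> 0^'+]).

Definition twice_ddifferentiable (R : realType) (m : nat)
    (f : 'rV[R]_m -> R) (x : 'rV[R]_m) : Prop :=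
  ddifferentiable f x /\ forall d, cvg (dquot2 f x d t @[t --> 0^'+]).

Definition locally_lipschitz_near (R : realType) (m : nat)
    (f : 'rV[R]_m -> R) (x : 'rV[R]_m) : Prop :=
  exists2 U : set 'rV[R]_m, nbhs x U & [lipschitz f y | y in U].

(* tau_k decreases to 0 in the sense usual for tangent cones: positive terms
   with limit 0, monotonicity not being required. *)
Definition cvg_to0_pos (R : realType) (tau : nat -> R) : Prop :=
  (forall k, 0 < tau k) /\ tau k @[k --> \oo] --> (0 : R).

Definition tangent_cone (R : realType) (m : nat) (F : set 'rV[R]_m)
    (x : 'rV[R]_m) : set 'rV[R]_m :=
  [set d | exists (xs : nat -> 'rV[R]_m) (tau : nat -> R),
     [/\ xs k @[k --> \oo] --> x, forall k, F (xs k), cvg_to0_pos tau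
       & (tau k)^-1 *: (xs k - x) @[k --> \oo] --> d]].

Definition radial_cone (R : realType) (m : nat) (F : set 'rV[R]_m)
    (x : 'rV[R]_m) : set 'rV[R]_m :=
  [set d | exists2 tau : nat -> R, cvg_to0_pos tau
                                 & forall k, F (x + tau k *: d)].

Definition argmin (R : realType) (m : nat) (f : 'rV[R]_m -> R)
    (F : set 'rV[R]_m) : set 'rV[R]_m :=
  [set x | F x /\ forall y, F y -> f x <= f y].

Definition local_minimizer (R : realType) (m : nat) (f : 'rV[R]_m -> R)
    (F : set 'rV[R]_m) (x : 'rV[R]_m) : Prop :=
  F x /\ \forall y \near x, F y -> f x <= f y.

(* Main.v *)
Require Import Defs.
From mathcomp Require Import all_boot all_order all_algebra.
From mathcomp Require Import all_classical all_reals topology normedtype.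

Set Implicit Arguments.
Unset Strict Implicit.
Unset Printing Implicit Defensive.

Import Order.TTheory GRing.Theory Num.Theory.
Import numFieldNormedType.Exports.

Local Open Scope classical_set_scope.
Local Open Scope ring_scope.

(** A local minimizer makes every difference quotient along feasible points
eventually nonnegative, and nonnegativity survives passing to the limit.

On the tangent cone the feasible points [xs k] need not lie on the ray
[xbar + tau k *: d].  The Lipschitz property bounds the cost of replacing one
by the other: divided by [tau k], it is at most
[M * `|d - (tau k)^-1 *: (xs k - xbar)|], which tends to 0.  Hence
[M * `|d - (tau k)^-1 *: (xs k - xbar)| + dquot f xbar d (tau k)] is
eventually nonnegative ([lipschitz_dquot_ge]), and its limit is
[ddir f xbar d].

On the radial cone the points of the ray are themselves feasible; when
[ddir f xbar d = 0] the second-order quotient is then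
[(f (xbar + tau k *: d) - f xbar) / (tau k ^+ 2 / 2)], and local
minimality at once makes it eventually nonnegative. *)

Lemma cvg_to0_pos_at_right (R : realType) (tau : nat -> R) :
  cvg_to0_pos tau -> tau k @[k --> \oo] --> 0^'+.
Proof.
move=> [tau_gt0 tau0] A A_right.
apply: (@filterS _ \oo _ _ _ _ (tau0 _ A_right)) => k; apply.
exact: tau_gt0.
Qed.

Lemma cvg_ray (R : realType) (m : nat) (x d : 'rV[R]_m) (tau : nat -> R) :
  cvg_to0_pos tau -> x + tau k *: d @[k --> \oo] --> x.
Proof.
move=> [_ tau0]; rewrite -[X in _ --> X]addr0 -(scale0r d).
by apply: cvgD; [exact: cvg_cst | exact: cvgZr_tmp].
Qed.

(** The limit at [0^'+] exists, so it can be computed along the single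
sequence [tau], even though nothing is known about the sign of [q] elsewhere;
[e] absorbs a vanishing error in the lower bound on [q (tau k)]. *)
Lemma lim_at_right_ge0 (R : realType) (q : R -> R) (e tau : nat -> R) :
  cvg_to0_pos tau -> cvg (q t @[t --> 0^'+]) -> e k @[k --> \oo] --> (0 : R) ->
  (\forall k \near \oo, 0 <= e k + q (tau k)) -> 0 <= lim (q t @[t --> 0^'+]).
Proof.
move=> /cvg_to0_pos_at_right tau_right q_cvg e0 ge0.
have q_tau : q (tau k) @[k --> \oo] --> lim (q t @[t --> 0^'+]).
  exact: cvg_comp tau_right q_cvg.
have sum_cvg : e k + q (tau k) @[k --> \oo] --> lim (q t @[t --> 0^'+]).
  by rewrite -[X in _ --> X]add0r; exact: cvgD.
rewrite -(cvg_lim _ sum_cvg)//; apply: limr_ge ge0.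
exact: cvgP sum_cvg.
Qed.

Lemma locally_lipschitz_nearP (R : realType) (m : nat) (f : 'rV[R]_m -> R)
    (x : 'rV[R]_m) :
  locally_lipschitz_near f x -> exists U : set 'rV[R]_m, exists M : R,
    nbhs x U /\ forall y z, U y -> U z -> `|f y - f z| <= M * `|y - z|.
Proof.
(* Constants near +oo are those strictly above [M0], hence [M0 + 1]. *)
move=> [U Ux] [M0 [_ lipM]]; exists U, (M0 + 1); split=> // y z Uy Uz.
by apply: (lipM (M0 + 1) _ (y, z)) => //; rewrite ltrDl.
Qed.

(** Minimality gives [f x <= f y] at a point [y] off the ray, the Lipschitz
bound transfers it to the ray point at a cost, and dividing by [t] turns that
cost into the distance from [d] to the secant direction of [y]. *)
Lemma lipschitz_dquot_ge (R : realType) (m : nat) (f : 'rV[R]_m -> R)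
    (x d y : 'rV[R]_m) (t M : R) :
  0 < t -> f x <= f y ->
  `|f y - f (x + t *: d)| <= M * `|y - (x + t *: d)| ->
  0 <= M * `|d - t^-1 *: (y - x)| + dquot f x d t.
Proof.
move=> t_gt0 fxy lip.
have -> : `|d - t^-1 *: (y - x)| = `|y - (x + t *: d)| / t.
  have -> : d - t^-1 *: (y - x) = - (t^-1 *: (y - (x + t *: d))).
    rewrite opprD addrA [in RHS]scalerBr scalerA mulVf ?gt_eqF//.
    by rewrite scale1r opprB.
  by rewrite normrN normrZ gtr0_norm ?invr_gt0// mulrC.
rewrite /dquot mulrA -mulrDl divr_ge0 ?(ltW t_gt0)//.
rewrite addrA subr_ge0 (le_trans fxy)// -lerBlDr.
exact: le_trans (ler_norm _) lip.
Qed.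

Lemma ddir_tangent_ge0 (R : realType) (m : nat) (f : 'rV[R]_m -> R)
    (F : set 'rV[R]_m) (x d : 'rV[R]_m) :
  local_minimizer f F x -> cvg (dquot f x d t @[t --> 0^'+]) ->
  locally_lipschitz_near f x -> tangent_cone F x d -> 0 <= ddir f x d.
Proof.
move=> [_ fmin] f_ddiff /locally_lipschitz_nearP[U [M [Ux lip]]].
move=> [xs [tau [xs_x Fxs tau0 dir_d]]].
apply: (@lim_at_right_ge0 _ _
  (fun k => M * `|d - (tau k)^-1 *: (xs k - x)|) tau) => //.
  rewrite -(mulr0 M) -(@normr0 _ 'rV[R]_m) -(subrr d).
  by apply: cvgMl_tmp; apply: cvg_norm; apply: cvgB => //; exact: cvg_cst.
have fxs : \forall k \near \oo, F (xs k) -> f x <= f (xs k) := xs_x _ fmin.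
have Uxs : \forall k \near \oo, U (xs k) := xs_x _ Ux.
have Uray : \forall k \near \oo, U (x + tau k *: d).
  exact: (cvg_ray d tau0 Ux).
near=> k; apply: (@lipschitz_dquot_ge _ _ _ _ _ (xs k)).
- exact: tau0.1.
- by have := Fxs k; near: k.
- by apply: lip; near: k.
Unshelve. all: by end_near. Qed.

Lemma ddir2_radial_ge0 (R : realType) (m : nat) (f : 'rV[R]_m -> R)
    (F : set 'rV[R]_m) (x d : 'rV[R]_m) :
  local_minimizer f F x -> cvg (dquot2 f x d t @[t --> 0^'+]) ->
  radial_cone F x d -> ddir f x d = 0 -> 0 <= ddir2 f x d.
Proof.
move=> [_ fmin] f_ddiff2 [tau tau0 Fray] ddir0.
apply: (@lim_at_right_ge0 _ _ (fun=> 0) tau) => //; first exact: cvg_cst.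
apply: (@filterS _ \oo _ _ _ _ (cvg_ray d tau0 fmin)) => k fray.
rewrite add0r /dquot2 ddir0 mulr0 subr0 divr_ge0 ?divr_ge0 ?sqr_ge0//.
by rewrite subr_ge0; apply: fray; exact: Fray.
Qed.

Theorem lemma3p1 (R : realType) (m : nat) (f : 'rV[R]_m -> R)
    (F : set 'rV[R]_m) (xbar : 'rV[R]_m)
    (argmin_neq0 : argmin f F !=set0)
    (xbar_locmin : local_minimizer f F xbar)
    (f_ddiff : ddifferentiable f xbar)
    (f_lip : locally_lipschitz_near f xbar) :
  (forall d, tangent_cone F xbar d -> 0 <= ddir f xbar d) /\
  (twice_ddifferentiable f xbar ->
   forall d, (radial_cone F xbar `&` [set d | ddir f xbar d = 0]) d ->
   0 <= ddir2 f xbar d).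
Proof.
split=> [d|[_ f_ddiff2] d [d_radial ddir0]].
  exact: ddir_tangent_ge0.
exact: ddir2_radial_ge0 d_radial ddir0.
Qed.
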